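(* Let $K$ be a complex cubic field and let $L$ be a cubic field not isomorphic to $K$. Then $\mathrm{sh}(K)\neq\mathrm{sh}(L)$. In particular, the shape is a complete invariant in the family of complex cubic fields: two complex cubic fields with the same shape are isomorphic.
   Context: A cubic field is a number field of degree 3; it is complex if it has exactly one real embedding (and one pair of complex conjugate embeddings). For a cubic field $K$ with embeddings $\sigma_1,\sigma_2,\sigma_3:K\to\mathbf{C}$ and ring of integers $\mathcal{O}_K$, define the perp map $\alpha\mapsto\alpha^\perp:=3\alpha-\mathrm{Tr}_{K/\mathbf{Q}}(\alpha)$. If $1,\alpha_1,\alpha_2$ is a $\mathbf{Z}$-basis of $\mathcal{O}_K$, let $M(x,y)=\sum_{i=1}^3|\sigma_i(x\alpha_1^\perp+y\alpha_2^\perp)|^2$, a positive definite real binary quadratic form. For a positive definite form $Q=rx^2+sxy+ty^2$ put $z(Q)=\frac{s}{2r}+i\frac{\sqrt{4rt-s^2}}{2r}$ in the upper half-plane $\mathfrak{H}$. The shape $\mathrm{sh}(K)$ is the orbit of $z(M)$ in $\mathrm{GL}_2(\mathbf{Z})\backslash\mathfrak{H}$ (where $g=\begin{pmatrix}a&b\\c&d\end{pmatrix}$ acts by $z\mapsto\frac{az+b}{cz+d}$ if $\det g=1$ and $z\mapsto\frac{a\bar z+b}{c\bar z+d}$ if $\det g=-1$); it is independent of the chosen basis. Equivalently, $\mathrm{sh}(K)$ is the lattice $\{(\sigma_i(\gamma^\perp))_i:\gamma\in\mathcal{O}_K\}\subset\mathbf{C}^3$ with the standard Hermitian inner product, up to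 scaling, rotations and reflections. *)

(* Defs.v *)
From HB Require Import structures.
From mathcomp Require Import all_boot all_order all_algebra all_field.
From mathcomp Require Import boolp classical_sets reals.
From mathcomp Require Import complex.

Set Implicit Arguments.
Unset Strict Implicit.
Unset Printing Implicit Defensive.

Import Order.TTheory GRing.Theory Num.Theory.
Local Open Scope classical_set_scope.
Local Open Scope ring_scope.

Definition cubic_field (K : fieldExtType rat) : Prop := \dim {:K} = 3%N.

(* Ring morphisms are compared extensionally. *)
Definition complex_cubic_field (R : realType) (K : fieldExtType rat) : Prop :=
  cubic_field K /\
  exists sigma : {rmorphism K -> R},
    forall tau : {rmorphism K -> R}, tau =1 sigma.

Definition isomorphic_fields (K L : fieldExtType rat) : Prop :=
  exists f : {rmorphism K -> L}, bijective f.

Definition ring_of_integers (K : fieldExtType rat) : set K :=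
  [set a | integralOver (intr : int -> K) a].

Definition field_trace (K : fieldExtType rat) (a : K) : rat :=
  \tr (passmx.mxof (vbasis {:K}) (vbasis {:K}) (amull a)).

Definition perp (K : fieldExtType rat) (a : K) : K :=
  a *+ 3 - (field_trace a)%:A.

(* (1, a1, a2) is a Z-basis of the ring of integers of K. *)
Definition integral_basis1 (K : fieldExtType rat) (a1 a2 : K) : Prop :=
  [/\ ring_of_integers a1, ring_of_integers a2
    & forall a : K, ring_of_integers a ->
        exists! c : int * int * int,
          a = c.1.1%:~R + a1 *~ c.1.2 + a2 *~ c.2].

Definition complex_embeddings (R : realType) (K : fieldExtType rat)
    (sigma : 'I_3 -> {rmorphism K -> R[i]}) : Prop :=
  forall tau : {rmorphism K -> R[i]}, exists! i : 'I_3, tau =1 sigma i.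

Definition shape_form (R : realType) (K : fieldExtType rat)
    (sigma : 'I_3 -> {rmorphism K -> R[i]}) (a1 a2 : K) (x y : int) : R :=
  \sum_(i < 3) Normc.normc (sigma i (perp a1 *~ x + perp a2 *~ y)) ^+ 2.

(* The coefficients of Q = r x^2 + s x y + t y^2 are recovered from the
   values of Q at (1, 0), (0, 1) and (1, 1). *)
Definition form_point (R : realType) (Q : int -> int -> R) : R[i] :=
  let r := Q 1 0 in
  let t := Q 0 1 in
  let s := Q 1 1 - r - t in
  Complex (s / (2 * r)) (Num.sqrt (4 * r * t - s ^+ 2) / (2 * r)).

(* For g in GL_2(Z), i.e. \det g = 1 or \det g = -1. *)
Definition GL2Z_act (R : realType) (g : 'M[int]_2) (z : R[i]) : R[i] :=
  let z' := if \det g == 1 then z else conjc z in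
  ((g 0 0)%:~R * z' + (g 0 1)%:~R) / ((g 1 0)%:~R * z' + (g 1 1)%:~R).

Definition GL2Z_orbit (R : realType) (z : R[i]) : set R[i] :=
  [set w | exists2 g : 'M[int]_2, g \in unitmx & w = GL2Z_act g z].

(* A point of GL_2(Z)\H is represented by the corresponding orbit, a set of
   complex numbers. The orbit of the point of shape_form does not depend on
   the integral basis or on the enumeration of the embeddings, so the union
   over all these choices is that single orbit. *)
Definition cubic_shape (R : realType) (K : fieldExtType rat) : set R[i] :=
  [set w | exists sigma : 'I_3 -> {rmorphism K -> R[i]},
           exists a1 a2 : K,
    [/\ complex_embeddings sigma, integral_basis1 a1 a2
      & GL2Z_orbit (form_point (shape_form sigma a1 a2)) w]].
Arguments cubic_shape R K : clear implicits.

(* Main.v *)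
Require Import Defs.
From HB Require Import structures.
From mathcomp Require Import all_boot all_order all_algebra all_field.
From mathcomp Require Import boolp classical_sets reals.
From mathcomp Require Import complex.
From mathcomp Require Import ring lra.

(** For [a] of trace zero put [q a := perp (a ^ 2) = 3 a ^ 2 - Tr (a ^ 2)].
    If [K] is complex with real embedding [rho], then [M a = rho (q a)], because
    the two other conjugates of [a] are complex conjugate with real part
    [- rho a / 2]. If [L] is totally real, [M] takes the rational values
    [Tr (a ^ 2)]. In both cases the coefficients of [M] lie in the image of one
    real embedding, and the set of points [z] with [Re z] and [|z| ^ 2] in a
    given subfield of the reals is stable under [GL_2(Z)]. So if [K] and [L]
    have the same shape and [u], [v] are the perps of a basis of [O_K], both
    [q v / q u] and [(q (u + v) - q u - q v) / q u] are mapped by [rho] into the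
    real image of [L]. They are not both rational, as otherwise [v / u] would be
    a root of a rational quadratic polynomial. Hence the real images of [K] and
    [L] share an irrational number, which generates both cubic fields. *)

Set Implicit Arguments.
Unset Strict Implicit.
Unset Printing Implicit Defensive.

Import Order.TTheory GRing.Theory Num.Theory.
Local Open Scope ring_scope.
Local Open Scope complex_scope.

(** * Generators, minimal polynomials and embeddings of cubic fields *)

Lemma rmorph_ratA (K : fieldExtType rat) (F : fieldType)
  (f : {rmorphism K -> F}) (q : rat) : f q%:A = ratr q.
Proof. exact: (fmorph_eq_rat (f \o in_alg K)). Qed.

Lemma rmorph_horner_ratA (K : fieldExtType rat) (F : fieldType)
    (f : {rmorphism K -> F}) (p : {poly rat}) (x : K) :
  f (map_poly (in_alg K) p).[x] = (map_poly ratr p).[f x].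
Proof.
rewrite -horner_map -map_poly_comp; congr (_.[_]); apply: eq_map_poly => q.
exact: rmorph_ratA.
Qed.

Section CubicFields.

Variable K : fieldExtType rat.
Hypothesis cubicK : cubic_field K.

(** The degree of [x] divides 3 and is not 1. *)
Lemma cubic_adjoin_degree (x : K) :
  x \notin 1%VS -> adjoin_degree 1%AS x = 3%N.
Proof.
move=> xNQ; have := field_dimS (subvf <<1; x>>%AS).
rewrite cubicK dim_Fadjoin dimv1 muln1.
rewrite dvdn_divisors // !inE adjoin_deg_eq1 (negPf xNQ) /=.
by move/eqP.
Qed.

Lemma cubic_generator (x y : K) : x \notin 1%VS ->
  exists p : {poly rat}, y = (map_poly (in_alg K) p).[x].
Proof.
move=> xNQ; apply/Fadjoin1_polyP; suff -> : <<1; x>>%VS = fullv by exact: memvf.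
apply/eqP; rewrite eqEdim subvf cubicK dim_Fadjoin dimv1 muln1.
by rewrite cubic_adjoin_degree.
Qed.

Lemma cubic_root_small (x : K) (p : {poly rat}) : x \notin 1%VS ->
  (size p <= 3)%N -> (map_poly (in_alg K) p).[x] = 0 -> p = 0.
Proof.
move=> xNQ sp px0; apply/eqP; rewrite -(map_poly_eq0 (in_alg K)).
rewrite -(@root_small_adjoin_poly _ _ 1%AS x); first exact/rootP.
  exact: alg_polyOver.
by rewrite size_map_poly cubic_adjoin_degree.
Qed.

Lemma cubic_free (x : K) (a b c : rat) : x \notin 1%VS ->
  a%:A + b *: x + c *: x ^+ 2 = 0 -> [/\ a = 0, b = 0 & c = 0].
Proof.
move=> xNQ e.
have p0 : Poly [:: a; b; c] = 0.
  apply: (cubic_root_small xNQ); first exact: size_Poly.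
  rewrite -e /= !cons_poly_def mul0r add0r rmorphD rmorphM /= map_polyX map_polyC.
  rewrite rmorphD rmorphM /= map_polyX !map_polyC /= !hornerE.
  by rewrite -(mulr_algl b x) -(mulr_algl c (_ ^+ 2)); ring.
move/polyP: p0 => p0.
by move: (p0 0%N) (p0 1%N) (p0 2%N); rewrite !coef_Poly !coef0 /=.
Qed.

Lemma cubic_minpoly (x : K) : x \notin 1%VS ->
  exists p : {poly rat}, [/\ p \is monic, size p = 4%N &
    forall q, ((map_poly (in_alg K) q).[x] == 0) = (p %| q)].
Proof.
move=> xNQ; have /polyOver1P[p Dp] := minPolyOver 1%AS x.
exists p; split.
- by rewrite -(map_monic (in_alg K)) -Dp monic_minPoly.
- by rewrite -(size_map_poly (in_alg K)) -Dp size_minPoly cubic_adjoin_degree.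
move=> q; rewrite -(dvdp_map (in_alg K)) -Dp.
apply/idP/idP => [qx0|].
  by apply: minPoly_dvdp; [exact: alg_polyOver | exact: qx0].
by move=> /dvdpP[r ->]; rewrite hornerM minPolyxx mulr0.
Qed.

Lemma cubic_irrational_exists : exists x : K, x \notin 1%VS.
Proof.
apply/not_existsP => h; have : ({:K} <= 1)%VS.
  by apply/subvP => x _; apply/negPn/negP/h.
by move/dimvS; rewrite cubicK dimv1.
Qed.

Lemma cubic_morph_eq (F : fieldType) (f g : {rmorphism K -> F}) (x : K) :
  x \notin 1%VS -> f x = g x -> f =1 g.
Proof.
move=> xNQ e y; have [p ->] := cubic_generator y xNQ.
by rewrite !rmorph_horner_ratA e.
Qed.

End CubicFields.

(* [f] sends [p.[x]] to [p.[z]]; the hypothesis makes this well defined. *)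
Lemma rmorphism_of_root (K : fieldExtType rat) (F : numFieldType) (x : K) (z : F) :
    cubic_field K -> x \notin 1%VS ->
    (forall q : {poly rat}, (map_poly (in_alg K) q).[x] = 0 ->
       (map_poly ratr q).[z] = 0) ->
  exists f : {rmorphism K -> F}, f x = z.
Proof.
move=> cK xNQ hz.
have [g gP] := choice (fun y => cubic_generator cK y xNQ).
pose f y := (map_poly (ratr : rat -> F) (g y)).[z].
have fE y q : y = (map_poly (in_alg K) q).[x] -> f y = (map_poly ratr q).[z].
  move=> e; apply/eqP; rewrite -subr_eq0 -hornerN -hornerD -rmorphB; apply/eqP/hz.
  by rewrite rmorphB hornerD hornerN -gP -e subrr.
have fB : zmod_morphism f.
  by move=> u v; rewrite (fE _ (g u - g v)) ?rmorphB ?hornerD ?hornerN // -!gP.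
have fM : monoid_morphism f.
  split=> [|u v]; last by rewrite (fE _ (g u * g v)) ?rmorphM ?hornerM // -!gP.
  by rewrite (fE _ 1) ?rmorph1 ?hornerC.
pose hB := GRing.isZmodMorphism.Build K F f fB.
pose hM := GRing.isMonoidMorphism.Build K F f fM.
pose fr : {rmorphism K -> F} := HB.pack f hB hM.
by exists fr; rewrite /= (fE _ 'X) ?map_polyX ?hornerX.
Qed.

(** With [a] irrational, [b] is irrational too. Each field is generated by its element, so [f] and
    [g] have the same image, and the isomorphism is [f] followed by the inverse of [g] on that
    image. *)
Lemma isomorphic_of_common_irrational (K L : fieldExtType rat) (F : fieldType)
    (f : {rmorphism K -> F}) (g : {rmorphism L -> F}) (a : K) (b : L) :
    cubic_field K -> cubic_field L -> a \notin 1%VS -> f a = g b ->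
  isomorphic_fields K L.
Proof.
move=> cK cL aNQ e.
have bNQ : b \notin 1%VS.
  apply: contra aNQ => /vlineP[c]; move: e => /[swap] -> e.
  apply/vlineP; exists c; apply: (fmorph_inj f).
  by rewrite e !rmorph_ratA.
have fg x : exists y, f x = g y.
  have [p ->] := cubic_generator cK x aNQ.
  by exists (map_poly (in_alg L) p).[b]; rewrite !rmorph_horner_ratA e.
have gf y : exists x, f x = g y.
  have [p ->] := cubic_generator cL y bNQ.
  by exists (map_poly (in_alg K) p).[a]; rewrite !rmorph_horner_ratA e.
have [h hP] := choice fg; have [k kP] := choice gf.
have hB : zmod_morphism h.
  by move=> u v; apply: (fmorph_inj g); rewrite -hP !rmorphB -!hP.
have hM : monoid_morphism h.
  split=> [|u v]; apply: (fmorph_inj g); first by rewrite -hP !rmorph1.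
  by rewrite -hP !rmorphM -!hP.
pose hB' := GRing.isZmodMorphism.Build K L h hB.
pose hM' := GRing.isMonoidMorphism.Build K L h hM.
pose hr : {rmorphism K -> L} := HB.pack h hB' hM'.
exists hr; exists k => x.
  by apply: (fmorph_inj f); rewrite kP -hP.
by apply: (fmorph_inj g); rewrite -hP kP.
Qed.

(** Embeddings correspond to the roots of the minimal polynomial of an irrational [x], and these are
    three distinct complex numbers. *)
Lemma complex_embeddings_exist (R : realType) (K : fieldExtType rat) :
  cubic_field K ->
  exists sigma : 'I_3 -> {rmorphism K -> R[i]}, complex_embeddings sigma.
Proof.
move=> cK; have [x xNQ] := cubic_irrational_exists cK.
have [p [pM sp pP]] := cubic_minpoly cK xNQ.
pose P := map_poly (ratr : rat -> R[i]) p.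
have PM : P \is monic by rewrite map_monic.
have [rs DP] := closed_field_poly_normal P.
rewrite (monicP PM) scale1r in DP.
have srs : size rs = 3%N.
  have : size P = 4%N by rewrite size_map_poly.
  by rewrite DP size_prod_XsubC => -[].
have emb z : root P z -> exists f : {rmorphism K -> R[i]}, f x = z.
  move=> /rootP Pz; apply: (rmorphism_of_root cK xNQ) => q /eqP.
  by rewrite pP => /dvdpP[r ->]; rewrite rmorphM hornerM -/P Pz mulr0.
(* A double root would be [f x] for some embedding [f], so the derivative of [p], of degree 2, would
   vanish at [x]. It would then be 0, against its leading coefficient 3. *)
have urs : uniq rs.
  rewrite -separable_prod_XsubC -DP unlock; apply/Pdiv.ClosedField.coprimepP => z Pz.
  apply/negP => P'z; have [f fx] := emb z Pz.
  have /(cubic_root_small cK xNQ) : (size p^`() <= 3)%N.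
    by rewrite -ltnS -sp lt_size_deriv // -size_poly_eq0 sp.
  have p'x : (map_poly (in_alg K) p^`()).[x] = 0.
    apply: (fmorph_inj f); rewrite rmorph0 rmorph_horner_ratA fx -deriv_map.
    exact/eqP.
  move=> /(_ p'x)/polyP/(_ 2%N); rewrite coef_deriv coef0.
  by move: (monicP pM); rewrite lead_coefE sp /= => ->.
have /choice[sigma sP] : forall i : 'I_3, exists f : {rmorphism K -> R[i]},
    f x = nth 0 rs i.
  by move=> i; apply: emb; rewrite DP root_prod_XsubC mem_nth // srs.
exists sigma => tau.
have tr : tau x \in rs.
  rewrite -root_prod_XsubC -DP; apply/rootP.
  by rewrite -rmorph_horner_ratA; apply/eqP; rewrite fmorph_eq0 pP dvdpp.
have ti : (index (tau x) rs < 3)%N by rewrite -srs index_mem.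
exists (Ordinal ti); split=> [|j e].
  by apply: (cubic_morph_eq cK xNQ); rewrite sP /= nth_index.
apply: val_inj => /=; move: (e x); rewrite sP => ->.
by rewrite index_uniq // srs.
Qed.

(** * The trace as the sum of the conjugates *)

Section TraceFormula.

Variables (R : realType) (K : fieldExtType rat).
Variable sigma : 'I_3 -> {rmorphism K -> R[i]}.
Hypotheses (cubicK : cubic_field K) (embK : complex_embeddings sigma).

Lemma embedding_inj (i j : 'I_3) : sigma i =1 sigma j -> i = j.
Proof.
move=> e; have [k [_ uk]] := embK (sigma j).
by rewrite -(uk i) ?(uk j).
Qed.

(** Evaluating the relation at 1, x, x^2 for an irrational [x] gives a Vandermonde system. Its nodes
    are distinct because the value at [x] determines an embedding. *)
Lemma embeddings_independent (v : 'I_3 -> R[i]) :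
  (forall x, \sum_i v i * sigma i x = 0) -> forall i, v i = 0.
Proof.
move=> h; have [x xNQ] := cubic_irrational_exists cubicK.
pose V := Vandermonde 3 (\row_i sigma i x).
have VU : V \in unitmx.
  rewrite unitmxE unitfE det_Vandermonde; apply/prodf_neq0 => i _.
  apply/prodf_neq0 => j ij; rewrite !mxE subr_eq0; apply/eqP => e.
  by have := embedding_inj (cubic_morph_eq cubicK xNQ e) => ji; rewrite ji ltnn in ij.
have v0 : V *m (\col_i v i) = 0.
  apply/matrixP => k j; rewrite !mxE -[RHS](h (x ^+ k)); apply: eq_bigr => i _.
  by rewrite !mxE rmorphXn mulrC.
move=> i; have := mulKmx VU (\col_i v i); rewrite v0 mulmx0.
by move=> /matrixP/(_ i 0); rewrite !mxE.
Qed.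

(** The matrix [E] of conjugates of a basis diagonalises multiplication by [x]: [A *m E = E *m D].
    As [E] is invertible, [A] and [D] have the same trace. *)
Lemma field_trace_sum (x : K) :
  ratr (field_trace x) = \sum_i sigma i x :> R[i].
Proof.
pose e := vbasis {:K}.
pose E : 'M[R[i]]_(_, 3) := \matrix_(i, j) sigma j e`_(i : 'I_(\dim {:K})).
pose A := map_mx (ratr : rat -> R[i]) (passmx.mxof e e (amull x)).
pose D : 'M[R[i]]_3 := diag_mx (\row_j sigma j x).
have sigmaE j y : sigma j y =
    \sum_(k < \dim {:K}) ratr (coord e k y) * sigma j e`_k.
  rewrite {1}(coord_vbasis (memvf y)) rmorph_sum; apply: eq_bigr => k _ /=.
  by rewrite -mulr_algl rmorphM rmorph_ratA.
have AE : A *m E = E *m D.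
  apply/matrixP => i j; rewrite mul_mx_diag !mxE.
  rewrite mulrC -rmorphM sigmaE; apply: eq_bigr => k _.
  by rewrite !mxE /= passmx.vecof_delta lfunE.
(* A vector killed by [E] is a linear relation between the embeddings, first on the basis and then
   on all of [K]. *)
have fE : row_full E.
  rewrite /row_full -mxrank_tr; apply: inj_row_free => v v0; apply/rowP => j; rewrite mxE.
  apply: (@embeddings_independent (v 0)) => y.
  under eq_bigr => i _ do rewrite sigmaE mulr_sumr.
  rewrite exchange_big big1 //= => k _.
  move/rowP/(_ k): v0; rewrite !mxE => v0.
  rewrite -[RHS](mulr0 (ratr (coord e k y))) -[in RHS]v0 mulr_sumr.
  by apply: eq_bigr => i _; rewrite !mxE mulrCA.
have rE : row_free E by rewrite /row_free (eqP fE) cubicK.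
rewrite /field_trace -/e -[ratr _](trace_map_mx (ratr : {rmorphism rat -> R[i]})).
rewrite -/A -[A]mulmx1 -(mulmxVp rE) mulmxA AE mxtrace_mulC mulmxA mulVpmx //.
by rewrite mul1mx mxtrace_diag; apply: eq_bigr => i _; rewrite mxE.
Qed.

End TraceFormula.

(** * Linearity and nondegeneracy of the trace *)

Lemma cubic_span (K : fieldExtType rat) (x y : K) :
  cubic_field K -> x \notin 1%VS ->
  exists a b c : rat, y = a%:A + b *: x + c *: x ^+ 2.
Proof.
move=> cK xNQ; have [p ->] := cubic_generator cK y xNQ.
have [m [mM sm mP]] := cubic_minpoly cK xNQ.
have m0 : (map_poly (in_alg K) m).[x] = 0 by apply/eqP; rewrite mP.
rewrite (divp_eq p m) rmorphD rmorphM hornerD hornerM m0 mulr0 add0r.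
have : (size (p %% m)%R <= 3)%N by rewrite -ltnS -sm ltn_modp monic_neq0.
move: (p %% m) => q sq; exists q`_0, q`_1, q`_2.
rewrite (horner_coef_wide x (_ : _ <= 3)%N) ?size_map_poly //.
by rewrite !big_ord_recr big_ord0 !coef_map /= !mulr_algl expr0 add0r.
Qed.

Lemma field_trace_linear (K : fieldExtType rat) (c : rat) (x y : K) :
  field_trace (c *: x + y) = c * field_trace x + field_trace y.
Proof.
by rewrite /field_trace [amull _]linearP passmx.mxof_linear [LHS]linearP.
Qed.

Lemma field_trace0 (K : fieldExtType rat) : field_trace (0 : K) = 0.
Proof.
by have := field_trace_linear (-1) 0 (0 : K); rewrite scaler0 addr0 mulN1r addNr.
Qed.

Lemma field_traceZ (K : fieldExtType rat) (c : rat) (x : K) :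
  field_trace (c *: x) = c * field_trace x.
Proof. by rewrite -[c *: x]addr0 field_trace_linear field_trace0 addr0. Qed.

Lemma field_traceD (K : fieldExtType rat) (x y : K) :
  field_trace (x + y) = field_trace x + field_trace y.
Proof. by rewrite -[x]scale1r field_trace_linear scale1r mul1r. Qed.

Lemma field_traceB (K : fieldExtType rat) (x y : K) :
  field_trace (x - y) = field_trace x - field_trace y.
Proof. by rewrite field_traceD -scaleN1r field_traceZ mulN1r. Qed.

Lemma field_trace1 (K : fieldExtType rat) :
  field_trace (1 : K) = (\dim {:K})%:R.
Proof.
rewrite /field_trace amull1 passmx.mxof1 ?mxtrace1 //.
exact: basis_free (vbasisP _).
Qed.

Section TraceCubic.
Variable K : fieldExtType rat.
Hypothesis cubicK : cubic_field K.

Lemma field_trace_perp (x : K) : field_trace (perp x) = 0.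
Proof.
rewrite /perp field_traceB -scaler_nat field_traceZ field_traceZ field_trace1.
by rewrite cubicK mulrC subrr.
Qed.

Lemma perp_rational (x : K) : (perp x \in 1%VS) = (x \in 1%VS).
Proof.
by rewrite /perp rpredBr ?rpredZ ?rpred1 // -scaler_nat rpredZeq.
Qed.

(** For nonzero [x], the choice of its inverse as [y] gives Tr 1 = 3. *)
Lemma field_trace_nondegenerate (x : K) :
  (forall y, field_trace (x * y) = 0) -> x = 0.
Proof.
move=> h; apply/eqP/negPn/negP => x0.
by have := h x^-1; rewrite divff // field_trace1 cubicK.
Qed.

Lemma field_trace_nondegenerate3 (x a : K) : a \notin 1%VS ->
    field_trace x = 0 -> field_trace (x * a) = 0 ->
    field_trace (x * a ^+ 2) = 0 ->
  x = 0.
Proof.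
move=> aNQ t0 t1 t2; apply: field_trace_nondegenerate => y.
have [c [d [e ->]]] := cubic_span y cubicK aNQ.
rewrite !mulrDr !field_traceD -!scalerAr !field_traceZ mulr1.
by rewrite t0 t1 t2 !mulr0 !addr0.
Qed.

End TraceCubic.

(** * Integral elements and existence of an integral basis *)

Lemma fmorph_integral (F E : fieldType) (f : {rmorphism F -> E}) (x : F) :
  integralOver (intr : int -> E) (f x) <-> integralOver (intr : int -> F) x.
Proof.
have e p : map_poly intr p = map_poly f (map_poly intr p).
  by rewrite -map_poly_comp; apply: eq_map_poly => n /=; rewrite rmorph_int.
by split=> -[p pM]; [rewrite e fmorph_root | rewrite -(fmorph_root f) -e];
  exists p.
Qed.

(** The image of [t] in [algC] is a rational algebraic integer, hence an integer. *)
Lemma integral_rat (t : rat) :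
  integralOver (intr : int -> rat) t -> exists n : int, t = n%:~R.
Proof.
move/(fmorph_integral (ratr : {rmorphism rat -> algC})) => -[p pM pt].
apply/intrP; rewrite -Cint_rat; apply: Cint_rat_Aint; first exact: Crat_rat.
apply: root_monic_Aint pt _ _; first exact: monic_map.
by apply/polyOverP => i; rewrite coef_map intr_int.
Qed.

Lemma integral_intr (F : fieldType) (n : int) :
  integralOver (intr : int -> F) n%:~R.
Proof. exact: (integral_id (intr : {rmorphism int -> F})). Qed.

(** The multiplier is the leading coefficient [a] of an integer polynomial [q] vanishing at [x]. *)
Lemma integral_multiple (K : fieldExtType rat) (x : K) :
  exists2 N : int, N != 0 & ring_of_integers (x *~ N).
Proof.
have /polyOver1P[p Dp] := minPolyOver 1%AS x.
have pM : p \is monic by rewrite -(map_monic (in_alg K)) -Dp monic_minPoly.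
have px : (map_poly (in_alg K) p).[x] = 0 by rewrite -Dp minPolyxx.
have [q [a a0 Dq]] := rat_poly_scale p.
exists a => //.
have aQ : a%:~R != 0 :> rat by rewrite intr_eq0.
have qx : (map_poly (intr : int -> K) q).[x] = 0.
  have -> : map_poly (intr : int -> K) q = map_poly (in_alg K) (map_poly intr q).
    by rewrite -map_poly_comp; apply: eq_map_poly => n /=; rewrite scaler_int.
  have -> : map_poly intr q = a%:~R *: p by rewrite Dq scalerA divff ?scale1r.
  by rewrite map_polyZ hornerZ px mulr0.
have sq : size q = size p by rewrite Dq size_scale ?invr_eq0 // size_rat_int_poly.
(* [q] is [a] times the monic polynomial [p]. *)
have lq : lead_coef q = a.
  apply: (intr_inj : injective (intr : int -> rat)).
  have := monicP pM; rewrite Dq lead_coefZ lead_coef_map_inj //; last exact: intr_inj.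
  by move/(canRL (mulKf _)); rewrite invrK mulr1 invr_eq0; apply.
have [n sn] : exists n, size q = n.+2.
  by exists (\dim_(1%AS : {vspace K}) <<1; x>>).-1; rewrite sq -(size_map_poly (in_alg K)) -Dp size_minPoly.
move: lq; rewrite lead_coefE sn /= => lq.
(* The monic polynomial 'X^(n+1) + t takes at a x the value a^n q(x), which is 0; here [q] has
   degree n + 1. *)
pose t := \poly_(i < n.+1) (q`_i * a ^+ (n - i)).
exists ('X^(n.+1) + t).
  rewrite monicE lead_coefDl ?lead_coefXn // size_polyXn.
  exact: leq_ltn_trans (size_poly _ _) _.
apply/rootP; rewrite rmorphD /= map_polyXn hornerD hornerXn.
rewrite /t poly_def rmorph_sum horner_sum /=.
transitivity (a%:~R ^+ n * (map_poly (intr : int -> K) q).[x]); last first.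
  by rewrite qx mulr0.
rewrite (horner_coef_wide x (_ : _ <= n.+2)%N); last by rewrite -sn size_poly.
rewrite [in RHS]big_ord_recr /= addrC coef_map lq mulrDr mulr_sumr; congr (_ + _).
  by rewrite -(mulrzr x) exprMn 2!exprSr /=; ring.
apply: eq_bigr => i _; rewrite map_polyZ map_polyXn hornerZ hornerXn /= coef_map.
rewrite rmorphM rmorphXn /= -(mulrzr x) exprMn /=.
have -> : a%:~R ^+ n = a%:~R ^+ (n - i) * a%:~R ^+ i :> K.
  by rewrite -exprD subnK // -ltnS.
by ring.
Qed.

(** Euclidean division: [w] realises the least positive value of [f] on [O], and the remainder of
    [f x] modulo that value is again a value of [f] on [O], hence 0. *)
Lemma additive_generator (V : zmodType) (O : V -> Prop) (f : V -> rat) :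
    {morph f : x y / x - y} ->
    (forall x y, O x -> O y -> O (x - y)) ->
    (forall x, O x -> exists n : int, f x = n%:~R) ->
    (exists2 x, O x & f x != 0) ->
  exists w, [/\ O w, f w != 0 &
    forall x, O x -> exists c : int, f (x - w *~ c) = 0 /\ O (x - w *~ c)].
Proof.
move=> fB OB fZ [x0 Ox0 fx0].
have O0 : O 0 by rewrite -(subrr x0); apply: OB.
have ON x : O x -> O (- x) by rewrite -[- x]sub0r; apply: OB.
have OD x y : O x -> O y -> O (x + y).
  by move=> Ox Oy; rewrite -[y]opprK; apply: OB => //; apply: ON.
have OM x (c : int) : O x -> O (x *~ c).
  move=> Ox; have On n : O (x *+ n).
    by elim: n => [|n IH]; rewrite ?mulr0n // mulrS; apply: OD.
  by case: c => n; [exact: On | rewrite NegzE mulrNz; apply/ON/On].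
have f0 : f 0 = 0 by rewrite -(subrr 0) fB subrr.
have fN x : f (- x) = - f x by rewrite -[- x]sub0r fB f0 sub0r.
have fD x y : f (x + y) = f x + f y by rewrite -{1}[y]opprK fB fN opprK.
have fM x (c : int) : f (x *~ c) = f x *~ c.
  have fn n : f (x *+ n) = f x *+ n.
    by elim: n => [|n IH]; rewrite ?mulr0n // !mulrS fD IH.
  by case: c => n; [exact: fn | rewrite NegzE !mulrNz fN; congr (- _); exact: fn].
pose P n := `[< (0 < n)%N /\ exists2 x, O x & f x = n%:R >].
have exP : exists n, P n.
  have [m fm] := fZ _ Ox0; exists `|m|%N; apply/asboolP; split.
    by rewrite absz_gt0; apply: contra fx0 => /eqP m0; rewrite fm m0.
  exists (x0 *~ sgz m); first exact: OM.
  by rewrite fM fm -mulrzA mulrC -abszEsg.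
have [n /asboolP[n0 [w Ow fw]] nmin] := ex_minnP exP.
exists w; split=> // [|x Ox]; first by rewrite fw pnatr_eq0 -lt0n.
have [m fx] := fZ _ Ox; exists (m %/ n)%Z.
have Oy : O (x - w *~ (m %/ n)%Z) by apply/OB/OM.
split=> //; have fy : f (x - w *~ (m %/ n)%Z) = (m %% n)%Z%:~R.
  by rewrite fB fM fx fw {1}(divz_eq m n) intrD intrM -mulrzr; ring.
rewrite fy; have : 0 <= (m %% n)%Z by rewrite modz_ge0 // -lt0n.
have : (m %% n)%Z < n by rewrite ltz_pmod.
case: (m %% n)%Z fy => // -[|k] fy // kn _.
suff /nmin : P k.+1 by rewrite leqNgt -ltz_nat kn.
by apply/asboolP; split=> //; exists (x - w *~ (m %/ n)%Z).
Qed.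

Section IntegralBasis.
Variables (R : realType) (K : fieldExtType rat).
Hypothesis cubicK : cubic_field K.

Local Notation O := (integralOver (intr : int -> K)).

(** The trace is rational, and it is a sum of conjugates of [x], all of them integral. *)
Lemma field_trace_integral (x : K) : O x -> exists n : int, field_trace x = n%:~R.
Proof.
move=> Ox; have [sigma embK] := complex_embeddings_exist R cubicK.
apply: integral_rat.
apply/(fmorph_integral (ratr : {rmorphism rat -> R[i]})).
rewrite /= (field_trace_sum cubicK embK).
apply: (big_ind (integralOver (intr : int -> R[i]))).
- exact: (integral_intr _ 0).
- exact: (@integral_add _ _ (intr : {rmorphism int -> R[i]})).
by move=> i _; apply/fmorph_integral.
Qed.

Let OB x y : O x -> O y -> O (x - y).
Proof. exact: (@integral_sub _ _ (intr : {rmorphism int -> K})). Qed.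

Let OM x y : O x -> O y -> O (x * y).
Proof. exact: (@integral_mul _ _ (intr : {rmorphism int -> K})). Qed.

Let OMz x n : O x -> O (x *~ n).
Proof. by move=> Ox; rewrite -mulrzr; apply: OM => //; apply: integral_intr. Qed.

Lemma integral_perp (x : K) : O x -> O (perp x).
Proof.
move=> Ox; rewrite /perp; have [n ->] := field_trace_integral Ox.
apply: OB; first exact: (OMz 3).
by rewrite scaler_int; apply: integral_intr.
Qed.

Lemma integral_irrational_trace0 :
  exists a : K, [/\ O a, a \notin 1%VS & field_trace a = 0].
Proof.
have [x xNQ] := cubic_irrational_exists cubicK.
have [N N0 Nx] := integral_multiple x.
exists (perp (x *~ N)); split; first exact: integral_perp.
  rewrite perp_rational -scaler_int rpredZeq negb_or xNQ andbT.
  by rewrite intr_eq0.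
exact: field_trace_perp.
Qed.

(* Hermite reduction along the functionals [x => Tr (x a)] and [x => Tr (x b)],
   with [b] the perp of [a ^ 2]: they are integral on the integers of [K] and
   their common kernel is the line of rationals. *)
Lemma integral_basis1_exists : exists a1 a2 : K, integral_basis1 a1 a2.
Proof.
have [a [Oa aNQ ta]] := integral_irrational_trace0.
have a0 : a != 0 by apply: contraNneq aNQ => ->; rewrite rpred0.
pose b := perp (a ^+ 2).
have Ob : O b by apply: integral_perp; rewrite expr2; apply: OM.
have tb : field_trace b = 0 by apply: field_trace_perp.
pose f (c x : K) := field_trace (x * c).
have fB c : {morph f c : x y / x - y}.
  by move=> x y; rewrite /f mulrBl field_traceB.
have fZ c x : O c -> O x -> exists n : int, f c x = n%:~R.
  by move=> Oc Ox; apply/field_trace_integral/OM.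
(* If both functionals vanish at [x], then [perp x] is orthogonal to 1, a and a^2 for the trace
   form, so it is 0. *)
have ker x : f a x = 0 -> f b x = 0 -> x \in 1%VS.
  move=> fax fbx; rewrite -perp_rational.
  have tx := field_trace_perp cubicK x.
  have fpx c : field_trace c = 0 -> f c x = 0 -> f c (perp x) = 0.
    move=> tc fcx; rewrite /f /perp mulrBl mulr_algl field_traceB field_traceZ.
    by rewrite -scaler_nat -scalerAl field_traceZ -/(f c x) fcx tc !mulr0 subr0.
  suff -> : perp x = 0 by rewrite rpred0.
  apply: (field_trace_nondegenerate3 cubicK aNQ tx (fpx _ ta fax)).
  have := fpx _ tb fbx; rewrite /f /b {2}/perp mulrBr mulr_algr field_traceB.
  rewrite field_traceZ tx mulr0 subr0 -scaler_nat -scalerAr field_traceZ.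
  by move/eqP; rewrite mulf_eq0 /= => /eqP.
have [w2 [Ow2 fw2 gen2]] : exists w, [/\ O w, f a w != 0 & forall x, O x ->
    exists c : int, f a (x - w *~ c) = 0 /\ O (x - w *~ c)].
  apply: additive_generator => //; first by move=> x; apply: fZ.
  (* The inverse of [a] pairs with [a] to Tr 1 = 3; the multiple by [N] makes it integral. *)
  have [N N0 ON] := integral_multiple a^-1; exists (a^-1 *~ N) => //.
  rewrite /f mulrzAl mulVf // -scaler_int field_traceZ field_trace1 cubicK.
  by rewrite mulf_neq0 ?intr_eq0.
have [w1 [[Ow1 faw1] fw1 gen1]] : exists w, [/\ O w /\ f a w = 0, f b w != 0 &
    forall x, O x /\ f a x = 0 -> exists c : int, f b (x - w *~ c) = 0 /\
      (O (x - w *~ c) /\ f a (x - w *~ c) = 0)].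
  apply: (@additive_generator _ (fun x => O x /\ f a x = 0)) => //.
  - by move=> x y [Ox fx] [Oy fy]; split; [apply: OB|rewrite fB fx fy subrr].
  - by move=> x [Ox _]; apply: fZ.
  (* The coefficients are chosen to give Tr(y a) = 0. If [y] were rational, Tr(a^2) and Tr(a^3)
     would vanish together with Tr a, forcing a = 0. So [y] is irrational, lies outside the common
     kernel, and [f b y] is not 0. *)
  pose y := field_trace (a ^+ 3) *: a - field_trace (a ^+ 2) *: a ^+ 2.
  have fay : f a y = 0.
    rewrite /f /y mulrBl -!scalerAl field_traceB !field_traceZ -exprSr -expr2.
    by rewrite mulrC subrr.
  have yNQ : y \notin 1%VS.
    apply/negP => /vlineP[c yc].
    have [_ t3 t2] : [/\ - c = 0, field_trace (a ^+ 3) = 0 &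
        - field_trace (a ^+ 2) = 0].
      apply: (cubic_free cubicK aNQ).
      by rewrite !scaleNr -addrA -/y yc addNr.
    move/eqP: a0; apply; apply: (field_trace_nondegenerate3 cubicK aNQ ta).
      by rewrite -expr2; apply/eqP; rewrite -oppr_eq0 t2.
    by rewrite -exprS.
  have [N N0 ON] := integral_multiple y.
  have fyN c : f c (y *~ N) = N%:~R * f c y.
    by rewrite /f mulrzAl -scaler_int field_traceZ.
  exists (y *~ N); first by rewrite fyN fay mulr0.
  rewrite fyN mulf_neq0 ?intr_eq0 //.
  by apply: contraNneq yNQ => fby; apply: ker.
have f1 c : field_trace c = 0 -> f c 1 = 0 by rewrite /f mul1r.
have fMz c x n : f c (x *~ n) = n%:~R * f c x.
  by rewrite /f mulrzAl -scaler_int field_traceZ.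
have fD c x y : f c (x + y) = f c x + f c y by rewrite /f mulrDl field_traceD.
have fc c (n : int) : field_trace c = 0 -> f c n%:~R = 0.
  by move=> tc; rewrite fMz f1 // mulr0.
exists w1, w2; split=> // x Ox.
have [c2 [fx2 Ox2]] := gen2 x Ox.
have [c1 [fx1 [Ox1 fx1']]] := gen1 _ (conj Ox2 fx2).
(* After both reductions the rest is rational and integral, hence an integer. *)
have /vlineP[q xq] := ker _ fx1' fx1.
have [n qn] : exists n : int, q = n%:~R.
  apply: integral_rat; apply/(fmorph_integral (in_alg K)).
  by rewrite /= -xq.
exists (n, c1, c2); split=> /=.
  by move: xq; rewrite qn scaler_int => <-; rewrite !subrK.
move=> [[n' c1'] c2'] /=; move/eqP: xq; rewrite qn scaler_int !subr_eq.
move/eqP=> -> e.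
(* The system is triangular: [f a] vanishes on integers and on [w1], so it isolates the coefficient
   of [w2]; then [f b] isolates that of [w1]. *)
have e2 : c2 = c2'.
  move/(congr1 (f a)): (e); rewrite !fD !fc // !fMz faw1 !mulr0 !add0r.
  by move/(mulIf fw2)/intr_inj.
move: e; rewrite -{}e2 => /addIr e.
have e1 : c1 = c1'.
  by move/(congr1 (f b)): (e); rewrite !fD !fc // !fMz !add0r => /(mulIf fw1)/intr_inj.
move: e; rewrite -{}e1 => /addIr e.
congr (_, _, _); apply: (intr_inj : injective (intr : int -> rat)).
by apply: (fmorph_inj (in_alg K)); rewrite /= !scaler_int.
Qed.

End IntegralBasis.

(** * Values of the shape form *)

Lemma normc_sqrC (R : realType) (z : R[i]) :
  (Normc.normc z ^+ 2)%:C = z * conjc z.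
Proof.
case: z => a b; rewrite /Normc.normc sqr_sqrtr ?addr_ge0 ?sqr_ge0 //.
by apply/eqP; rewrite eq_complex /=; apply/andP; split; apply/eqP; ring.
Qed.

(** The splitting is stated for every [V] so that it serves real, complex and counting sums
    alike. *)
Lemma ord3_third (i j : 'I_3) : i != j ->
  exists k, [/\ k != i, k != j &
    forall (V : nmodType) (F : 'I_3 -> V), \sum_l F l = F k + F i + F j].
Proof.
move=> ij; have [k] : exists k, k \notin [:: i; j].
  apply: contrapT => /forallNP h.
  have : (#|'I_3| <= #|[:: i; j]|)%N.
    apply/subset_leq_card/fintype.subsetP => l _.
    by case: (boolP (l \in [:: i; j])) => // lN; case: (h l).
  by move/leq_trans/(_ (card_size _)); rewrite card_ord.
rewrite !inE negb_or => /andP[ki kj]; exists k; split=> // V F.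
have u : uniq [:: k; i; j] by rewrite /= !inE negb_or ki kj ij.
have e : [:: k; i; j] =i predT.
  by apply/subset_cardP; rewrite ?subset_predT // (card_uniqP u) card_ord.
transitivity (\sum_(l in [:: k; i; j]) F l).
  by apply: eq_bigl => l; rewrite e.
by rewrite -big_uniq // !big_cons big_nil /= addr0 addrA.
Qed.

Lemma real_embedding (R : realType) (K : fieldExtType rat)
    (s : {rmorphism K -> R[i]}) : (forall x, conjc (s x) = s x) ->
  exists rho : {rmorphism K -> R}, forall x, (rho x)%:C = s x.
Proof.
move=> sR; pose f x := complex.Re (s x).
have fE x : (f x)%:C = s x.
  rewrite /f; move: (sR x); case: (s x) => a b /= [] /eqP.
  by rewrite eq_sym -addr_eq0 -mulr2n mulrn_eq0 /= => /eqP ->.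
have fB : zmod_morphism f.
  by move=> u v; apply: complexI; rewrite rmorphB /= !fE rmorphB.
have fM : monoid_morphism f.
  split=> [|u v]; apply: complexI; first by rewrite fE !rmorph1.
  by rewrite rmorphM /= !fE rmorphM.
pose hB := GRing.isZmodMorphism.Build K R f fB.
pose hM := GRing.isMonoidMorphism.Build K R f fM.
pose fr : {rmorphism K -> R} := HB.pack f hB hM.
by exists fr.
Qed.

(** The coordinate-free version of [shape_form], whose value at (x, y) is this function at
    [perp a1 *~ x + perp a2 *~ y]. *)
Definition sum_sqr_norm (R : realType) (K : fieldExtType rat)
    (sigma : 'I_3 -> {rmorphism K -> R[i]}) (x : K) : R :=
  \sum_(i < 3) Normc.normc (sigma i x) ^+ 2.

Section ShapeValues.
Variables (R : realType) (K : fieldExtType rat).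
Variable sigma : 'I_3 -> {rmorphism K -> R[i]}.
Hypotheses (cubicK : cubic_field K) (embK : complex_embeddings sigma).

Local Notation Sh := (sum_sqr_norm sigma).

Lemma conj_embedding (i : 'I_3) :
  exists j, forall x, conjc (sigma i x) = sigma j x.
Proof.
have [j [e _]] := embK (conjc \o sigma i : {rmorphism K -> R[i]}).
by exists j.
Qed.

(** Conjugation is an involution on the three embeddings: it is trivial, or it swaps two and fixes
    the third. *)
Lemma embeddings_real_or_conj :
  (forall i x, conjc (sigma i x) = sigma i x) \/
  exists i j k, [/\ k != i,
    forall (V : nmodType) (F : 'I_3 -> V), \sum_l F l = F k + F i + F j,
    forall x, conjc (sigma i x) = sigma j x &
    forall x, conjc (sigma k x) = sigma k x].
Proof.
have [p pP] := choice conj_embedding.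
have pK i : p (p i) = i.
  by apply: (embedding_inj embK) => x; rewrite -!pP conjcK.
have [h|/existsNP[i pi]] := pselect (forall i, p i = i).
  by left=> i x; rewrite pP h.
right; have ij : i != p i by rewrite eq_sym; apply/eqP.
have [k [ki kj kS]] := ord3_third ij.
exists i, (p i), k; split=> // x; rewrite pP.
suff -> : p k = k by [].
have [//|pk] := eqVneq (p k) k.
(* Counting [p k] among [k], [i] and [p i]: it must be one of them, and as [p] is an involution it
   can only be [k]. *)
have := kS nat (fun l => nat_of_bool (l == p k)).
rewrite (bigD1 (p k)) //= eqxx big1 => [|l /negPf->] //.
rewrite eq_sym (negPf pk).
have [e|_] := eqVneq i (p k); first by rewrite e pK eqxx in kj.
by rewrite (inj_eq (can_inj pK)) eq_sym (negPf ki).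
Qed.

Lemma sum_sqr_norm_real (x : K) :
  (forall i x, conjc (sigma i x) = sigma i x) ->
  Sh x = ratr (field_trace (x ^+ 2)).
Proof.
move=> h; apply: complexI; rewrite /Sh rmorph_sum fmorph_rat.
rewrite (field_trace_sum cubicK embK).
by apply: eq_bigr => i _; rewrite /= normc_sqrC h rmorphXn.
Qed.

(** Write s_l for the conjugates of [x]. The left side is s_k^2 + 2 s_i s_j, the right side 2 s_k^2
    - s_i^2 - s_j^2, and they agree because s_k = -(s_i + s_j). *)
Lemma sum_sqr_norm_complex (rho : {rmorphism K -> R}) (i j k : 'I_3) (x : K) :
    (forall (V : nmodType) (F : 'I_3 -> V), \sum_l F l = F k + F i + F j) ->
    (forall x, conjc (sigma i x) = sigma j x) ->
    (forall x, (rho x)%:C = sigma k x) -> field_trace x = 0 ->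
  Sh x = rho (perp (x ^+ 2)).
Proof.
move=> S ij rhoE tx; apply: complexI.
have t1 := field_trace_sum cubicK embK x.
have t2 := field_trace_sum cubicK embK (x ^+ 2).
rewrite tx rmorph0 S in t1; rewrite S !rmorphXn in t2.
have ji y : conjc (sigma j y) = sigma i y by rewrite -ij conjcK.
have kk y : conjc (sigma k y) = sigma k y by rewrite -rhoE conjc_real.
rewrite /sum_sqr_norm rmorph_sum S /= !normc_sqrC ij ji kk rhoE /perp.
rewrite rmorphB rmorphMn rmorph_ratA t2 rmorphXn.
have -> : sigma k x = - (sigma i x + sigma j x).
  by apply/eqP; rewrite -addr_eq0 addrA -t1.
ring.
Qed.

End ShapeValues.

(** * The action of integer matrices on points over a real subfield *)

Lemma det_mx22 (A : comPzRingType) (M : 'M[A]_2) :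
  \det M = M 0 0 * M 1 1 - M 0 1 * M 1 0.
Proof.
rewrite (expand_det_row _ 0) 2!big_ord_recl big_ord0 addr0.
rewrite /cofactor !det_mx11 !mxE /= expr0 mul1r expr1 mulN1r mulrN.
by congr (M _ _ * M _ _ - M _ _ * M _ _); apply/val_inj.
Qed.

Section PointsOverSubfield.
Variables (R : realType) (L : fieldExtType rat) (rho : {rmorphism L -> R}).

Definition in_image (y : R) : Prop := exists l, y = rho l.

(** The squared modulus replaces the imaginary part, which for the point of a form involves a square
    root that may lie outside the subfield. *)
Definition point_over_image (z : R[i]) : Prop :=
  in_image (complex.Re z) /\
  in_image (complex.Re z ^+ 2 + complex.Im z ^+ 2).

Lemma in_image_int (n : int) : in_image n%:~R.
Proof. by exists n%:~R; rewrite rmorph_int. Qed.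

Lemma in_imageD x y : in_image x -> in_image y -> in_image (x + y).
Proof. by move=> [a ->] [b ->]; exists (a + b); rewrite rmorphD. Qed.

Lemma in_imageM x y : in_image x -> in_image y -> in_image (x * y).
Proof. by move=> [a ->] [b ->]; exists (a * b); rewrite rmorphM. Qed.

Lemma in_imageV x : in_image x -> in_image x^-1.
Proof. by move=> [a ->]; exists a^-1; rewrite fmorphV. Qed.

Lemma point_over_image_conj z : point_over_image z -> point_over_image (conjc z).
Proof. by case: z => x y [hx hn]; split=> //=; rewrite sqrrN. Qed.

Lemma point_over_image_moebius (a b c d : int) (z : R[i]) : point_over_image z ->
  point_over_image ((a%:~R * z + b%:~R) / (c%:~R * z + d%:~R)).
Proof.
have intC (n : int) : n%:~R = (n%:~R : R)%:C by rewrite rmorph_int.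
rewrite !intC; case: z => x y [/= hx hn].
set A : R := a%:~R; set B : R := b%:~R; set C : R := c%:~R; set D : R := d%:~R.
set N := x ^+ 2 + y ^+ 2 in hn.
have [hA hB hC hD] : [/\ in_image A, in_image B, in_image C & in_image D].
  by split; apply: in_image_int.
have h2 : in_image 2 by exact: (in_image_int 2).
(* [n] and [m] are the squared moduli of C z + D and A z + B, and [e] is the real part of A z + B
   times the conjugate of C z + D. The image point has real part e / n and squared modulus m / n. *)
pose n := C ^+ 2 * N + 2 * C * D * x + D ^+ 2.
pose m := A ^+ 2 * N + 2 * A * B * x + B ^+ 2.
pose e := A * C * N + (A * D + B * C) * x + B * D.
have hn' : in_image n by do !apply: in_imageD; do !apply: in_imageM.
have hm : in_image m by do !apply: in_imageD; do !apply: in_imageM.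
have he : in_image e.
  apply: in_imageD; last exact: in_imageM.
  apply: in_imageD; first by do !apply: in_imageM.
  by apply: in_imageM => //; apply: in_imageD; apply: in_imageM.
have nE : (C * x - 0 * y + D) ^+ 2 + (C * y + 0 * x + 0) ^+ 2 = n.
  by rewrite /n /N; ring.
split=> /=; rewrite nE.
  suff -> : (A * x - 0 * y + B) * ((C * x - 0 * y + D) / n) -
      (A * y + 0 * x + 0) * - ((C * y + 0 * x + 0) / n) = e / n.
    by apply: in_imageM => //; apply: in_imageV.
  by rewrite /e /N; ring.
set u := _ * _ - _; set v := _ * _ + _.
suff -> : u ^+ 2 + v ^+ 2 = m / n by apply: in_imageM => //; apply: in_imageV.
(* If the denominator vanishes, both sides are 0, since the inverse of 0 is 0. *)
rewrite /u /v; have [n0|n0] := eqVneq n 0.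
  by rewrite n0 invr0; ring.
have -> : m / n = m * n / n ^+ 2 by field.
rewrite -[n in m * n]nE /m /N; field.
by [].
Qed.

(** The adjugate matrix inverts the action. The denominator c z + d is nonzero because [z] is not
    real and [c], [d] are not both 0. *)
Lemma moebius_inv (a b c d : int) (z : R[i]) : complex.Im z != 0 ->
    a * d - b * c != 0 ->
    let w := (a%:~R * z + b%:~R) / (c%:~R * z + d%:~R) in
  z = (d%:~R * w + (- b)%:~R) / ((- c)%:~R * w + a%:~R).
Proof.
move=> z0 det0 w.
have detC : a%:~R * d%:~R - b%:~R * c%:~R != 0 :> R[i].
  by rewrite -!intrM -intrB intr_eq0.
have den0 : c%:~R * z + d%:~R != 0.
  apply: contraNneq detC => e.
  have intC (n : int) : n%:~R = (n%:~R : R)%:C by rewrite rmorph_int.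
  have c0 : c%:~R = 0 :> R.
    move/(congr1 (@complex.Im R)): e; rewrite !intC; case: (z) z0 => x y /= y0.
    by rewrite mul0r !addr0 => /eqP; rewrite mulf_eq0 (negPf y0) orbF => /eqP.
  have c0' : c%:~R = 0 :> R[i] by rewrite intC c0.
  by move: e; rewrite c0' mul0r add0r => ->; rewrite !mulr0 subrr.
have e : (- c)%:~R * w + a%:~R = (a%:~R * d%:~R - b%:~R * c%:~R) / (c%:~R * z + d%:~R).
  by rewrite /w rmorphN /=; field.
rewrite e /w rmorphN /=; field.
by rewrite detC den0.
Qed.

(** The property passes from [z'] to the common point through [h], and from there to [z] through the
    adjugate of [g]; conjugation preserves it. *)
Lemma point_over_image_orbit (g h : 'M[int]_2) (z z' : R[i]) :
    g \in unitmx -> complex.Im z != 0 -> GL2Z_act g z = GL2Z_act h z' ->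
  point_over_image z' -> point_over_image z.
Proof.
rewrite unitmxE det_mx22 => gU z0 e hz'.
have hw : point_over_image (GL2Z_act g z).
  rewrite e /GL2Z_act; apply: point_over_image_moebius.
  by case: ifP => // _; apply: point_over_image_conj.
have det0 : g 0 0 * g 1 1 - g 0 1 * g 1 0 != 0.
  by apply: contraTneq gU => ->; rewrite unitr0.
move: hw; rewrite /GL2Z_act; set z1 := if _ then _ else _ => hw.
have z10 : complex.Im z1 != 0.
  by rewrite /z1; case: ifP => // _; case: (z) z0 => x y /=; rewrite oppr_eq0.
have : point_over_image z1.
  by rewrite (moebius_inv z10 det0); apply: point_over_image_moebius.
rewrite /z1; case: ifP => // _ /point_over_image_conj; by rewrite conjcK.
Qed.

Lemma form_point_over_image (Q : int -> int -> R) :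
  (forall x y, in_image (Q x y)) -> point_over_image (form_point Q).
Proof.
move=> hQ; rewrite /form_point /point_over_image /=.
move: (hQ 1 0) (hQ 0 1) (hQ 1 1).
move: (Q 1 0) (Q 0 1) (Q 1 1) => r t q hr ht hq.
have hN x : in_image x -> in_image (- x).
  by move=> hx; rewrite -mulN1r; apply: in_imageM => //; exact: (in_image_int (-1)).
have hs : in_image (q - r - t) by apply: in_imageD (hN _ ht); apply: in_imageD (hN _ hr).
have h2r : in_image (2 * r) by apply/in_imageM => //; exact: (in_image_int 2).
have hre : in_image ((q - r - t) / (2 * r)) by apply: in_imageM => //; apply: in_imageV.
split=> //; move: (q - r - t) hs hre => s hs hre; apply: in_imageD.
  exact: in_imageM.
rewrite exprMn; apply: in_imageM; last by apply: in_imageM; apply: in_imageV.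
(* For a negative argument [Num.sqrt] is 0, which lies in the image as well. *)
have [disc|disc] := leP 0 (4 * r * t - s ^+ 2); last first.
  by rewrite ltr0_sqrtr // expr0n; exact: (in_image_int 0).
rewrite sqr_sqrtr //; apply: in_imageD; last exact/hN/in_imageM.
by apply: in_imageM => //; apply: in_imageM => //; exact: (in_image_int 4).
Qed.

(** The square root disappears from the squared modulus of the point, which equals t / r, while the
    real part is s / (2 r). *)
Lemma form_point_ratios (Q : int -> int -> R) :
    let r := Q 1 0 in let t := Q 0 1 in let s := Q 1 1 - r - t in
    r != 0 -> 0 <= 4 * r * t - s ^+ 2 -> point_over_image (form_point Q) ->
  in_image (s / r) /\ in_image (t / r).
Proof.
move=> r t s r0 disc; rewrite /form_point -/r -/t -/s /point_over_image /=.
have -> : (s / (2 * r)) ^+ 2 + (Num.sqrt (4 * r * t - s ^+ 2) / (2 * r)) ^+ 2 = t / r.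
  by rewrite 2!exprMn sqr_sqrtr //; field.
move=> [h1 h2]; split=> //.
have -> : s / r = 2 * (s / (2 * r)) by field.
by apply: in_imageM => //; exact: (in_image_int 2).
Qed.

End PointsOverSubfield.

(** * Linear and quadratic relations between perps *)

Lemma perp_linear (K : fieldExtType rat) (c : rat) (x y : K) :
  perp (c *: x + y) = c *: perp x + perp y.
Proof.
rewrite /perp field_trace_linear mulrnDl scalerDl -scalerA scalerBr.
by rewrite -scalerMnr; ring.
Qed.

Lemma perp0 (K : fieldExtType rat) : perp (0 : K) = 0.
Proof. by rewrite /perp field_trace0 mul0rn scale0r subr0. Qed.

Lemma perpZ (K : fieldExtType rat) (c : rat) (x : K) : perp (c *: x) = c *: perp x.
Proof. by rewrite -[c *: x]addr0 perp_linear perp0 addr0. Qed.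

Lemma perpD (K : fieldExtType rat) (x y : K) : perp (x + y) = perp x + perp y.
Proof. by rewrite -{1}[x]scale1r perp_linear scale1r. Qed.

Lemma perp0_rational (K : fieldExtType rat) (x : K) :
  perp x = 0 -> x \in 1%VS.
Proof. by move=> x0; rewrite -perp_rational x0 rpred0. Qed.

(** The kernel of [perp] is the rational line, so a relation makes c a1 + d a2 a rational [q]. After
    clearing denominators, an integer has two expansions in the basis, which must coincide. *)
Lemma integral_basis1_perp_free (K : fieldExtType rat) (a1 a2 : K) (c d : rat) :
    integral_basis1 a1 a2 -> c *: perp a1 + d *: perp a2 = 0 ->
  c = 0 /\ d = 0.
Proof.
move=> [_ _ basis] e.
have /vlineP[q eq] : c *: a1 + d *: a2 \in 1%VS.
  by apply: perp0_rational; rewrite perpD !perpZ.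
pose D := denq c * denq d * denq q.
pose m := numq c * denq d * denq q.
pose n := numq d * denq c * denq q.
pose k := numq q * denq c * denq d.
have hz (x : rat) : (numq x)%:~R = x * (denq x)%:~R.
  by rewrite -{2}[x]divq_num_den divfK // intr_eq0 denq_eq0.
have hk : k%:~R = a1 *~ m + a2 *~ n.
  have := congr1 (fun x => D%:~R *: x) eq.
  rewrite /= scalerDr !scalerA => h.
  rewrite -[a1 *~ m]scaler_int -[a2 *~ n]scaler_int -[LHS]scaler_int.
  have -> : m%:~R = D%:~R * c by rewrite /m /D !intrM hz; ring.
  have -> : n%:~R = D%:~R * d by rewrite /n /D !intrM hz; ring.
  have -> : k%:~R = D%:~R * q by rewrite /k /D !intrM hz; ring.
  by [].
have [z [_ uz]] := basis k%:~R (integral_intr K k).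
have e1 : z = (k, 0, 0) by apply: uz; rewrite /= !mulr0z !addr0.
have e2 : z = (0, m, n) by apply: uz; rewrite /= add0r.
move: e2; rewrite e1 => -[_ /esym/eqP m0 /esym/eqP n0].
split; apply/eqP; rewrite -numq_eq0.
  by move: m0; rewrite /m !mulf_eq0 !denq_eq0 !orbF.
by move: n0; rewrite /n !mulf_eq0 !denq_eq0 !orbF.
Qed.

(* If both ratios were rational, [v / u] would satisfy a rational
   quadratic equation. *)
Lemma perp_products_irrational (K : fieldExtType rat) (u v : K) :
    cubic_field K -> u != 0 -> v / u \notin 1%VS -> perp (u ^+ 2) != 0 ->
  perp (u * v) / perp (u ^+ 2) \in 1%VS ->
  perp (v ^+ 2) / perp (u ^+ 2) \notin 1%VS.
Proof.
move=> cK u0 thNQ q0 /vlineP[mu emu]; apply/negP => /vlineP[la ela].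
have ratio x (c : rat) : perp x / perp (u ^+ 2) = c%:A ->
    exists d : rat, x = c *: u ^+ 2 + d%:A.
  move=> e; have : x - c *: u ^+ 2 \in 1%VS.
    apply: perp0_rational; rewrite -scaleNr perpD perpZ scaleNr.
    by move/(canRL (divfK q0)): e => ->; rewrite mulr_algl subrr.
  by move/vlineP=> [d ed]; exists d; rewrite -ed addrC subrK.
have [c2 e2] := ratio _ _ emu; have [c1 e1] := ratio _ _ ela.
have u20 : u ^+ 2 != 0 by rewrite expf_neq0.
(* Here u v = mu u^2 + c2 and v^2 = la u^2 + c1. Eliminating the constants gives c2 (v^2 - la u^2) =
   c1 (u v - mu u^2), a quadratic relation for v / u after division by u^2. Its coefficients vanish,
   and c2 = 0 leaves v / u = mu. *)
have [_ _ c20] : [/\ c1 * mu - c2 * la = 0, - c1 = 0 & c2 = 0].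
  apply: (cubic_free cK thNQ); apply: (mulIf u20); rewrite mul0r.
  rewrite -(mulr_algl _ (v / u)) -(mulr_algl _ (_ ^+ 2)).
  have -> : ((c1 * mu - c2 * la)%:A + (- c1)%:A * (v / u) +
      c2%:A * (v / u) ^+ 2) * u ^+ 2 =
      c2%:A * (v ^+ 2 - la%:A * u ^+ 2) - c1%:A * (u * v - mu%:A * u ^+ 2) :> K.
    have AE (a b : rat) : (a * b)%:A = a%:A * b%:A :> K.
      exact: (rmorphM (in_alg K)).
    by rewrite scalerBl !AE scaleNr; field.
  by rewrite e1 e2 -!(mulr_algl _ (u ^+ 2)); ring.
move/negP: thNQ; apply; apply/vlineP; exists mu.
apply: (mulIf u20); rewrite mulr_algl -[RHS]addr0 -(scale0r 1) -c20 -e2.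
by field.
Qed.

(** * The form of a complex cubic field *)

Section ComplexCubic.
Variables (R : realType) (K : fieldExtType rat).
Variable sigma : 'I_3 -> {rmorphism K -> R[i]}.
Variables a1 a2 : K.
Hypothesis complexK : complex_cubic_field R K.
Hypothesis embK : complex_embeddings sigma.
Hypothesis basisK : integral_basis1 a1 a2.

Let cubicK : cubic_field K := proj1 complexK.
Local Notation u := (perp a1).
Local Notation v := (perp a2).

Lemma shape_basis_neq0 : u != 0.
Proof.
apply/eqP => u0; have := integral_basis1_perp_free (c := 1) (d := 0) basisK.
by rewrite u0 scaler0 scale0r addr0 => /(_ erefl)[].
Qed.

Lemma shape_basis_ratio : v / u \notin 1%VS.
Proof.
apply/negP => /vlineP[c e]; have := integral_basis1_perp_free (c := - c) (d := 1) basisK.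
move/(canRL (divfK shape_basis_neq0)): e => ->.
by rewrite mulr_algl scale1r scaleNr addNr => /(_ erefl)[].
Qed.

(** All three embeddings would come from the unique real one and coincide. *)
Lemma complex_cubic_not_all_real :
  ~ (forall i x, conjc (sigma i x) = sigma i x).
Proof.
move=> h; have [_ [rho uniq_rho]] := complexK.
have e i x : sigma i x = (rho x)%:C.
  have [f fE] := real_embedding (h i); by rewrite -fE uniq_rho.
have := embedding_inj embK (i := ord0) (j := ord_max).
by move=> /(_ (fun x => etrans (e _ x) (esym (e _ x)))).
Qed.

(** [rho] is the embedding fixed by conjugation. The last two facts ensure that the point of the
    form is not real. *)
Lemma complex_cubic_form :
  exists rho : {rmorphism K -> R},
    (forall x, field_trace x = 0 -> sum_sqr_norm sigma x = rho (perp (x ^+ 2))) /\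
    let r := sum_sqr_norm sigma u in let t := sum_sqr_norm sigma v in
    let s := sum_sqr_norm sigma (u + v) - r - t in
    r != 0 /\ 0 < 4 * r * t - s ^+ 2.
Proof.
case: (embeddings_real_or_conj embK) => [/complex_cubic_not_all_real//|].
move=> [i [j [k [ki S ij kk]]]].
have [rho rhoE] := real_embedding kk; exists rho; split.
  by move=> x; apply: (sum_sqr_norm_complex cubicK embK S ij rhoE).
pose im x := complex.Im (sigma i x).
have sE x : field_trace x = 0 -> sigma i x = Complex (- rho x / 2) (im x).
  move=> tx; have := field_trace_sum cubicK embK x.
  rewrite tx rmorph0 S -rhoE -ij /im; case: (sigma i x) => a b /=.
  move/(congr1 (@complex.Re R)) => /= h; congr Complex.
  by lra.
have ShE x : field_trace x = 0 ->
    sum_sqr_norm sigma x = 3 / 2 * rho x ^+ 2 + 2 * im x ^+ 2.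
  move=> tx; rewrite /sum_sqr_norm S -ij -rhoE (sE x tx) /Normc.normc /=.
  rewrite !sqr_sqrtr ?addr_ge0 ?sqr_ge0 //.
  by field.
have imD x y : im (x + y) = im x + im y.
  by rewrite /im rmorphD; case: (sigma i x) (sigma i y) => a b [c d].
have tu : field_trace u = 0 by apply: field_trace_perp.
have tv : field_trace v = 0 by apply: field_trace_perp.
have tuv : field_trace (u + v) = 0 by rewrite field_traceD tu tv addr0.
move=> r t s; rewrite /s /r /t !ShE // (rmorphD rho u v) (imD u v).
have ru : rho u != 0 by rewrite fmorph_eq0 shape_basis_neq0.
split.
  have i0 := sqr_ge0 (im u); have r2 : 0 < rho u ^+ 2 by rewrite exprn_even_gt0.
  by rewrite gt_eqF //; lra.
(* If this determinant vanished, [sigma i] and [sigma k] would agree at the irrational element v / u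
   and so be equal. The discriminant is 12 times its square. *)
have w0 : rho v * im u - rho u * im v != 0.
  apply/eqP => e; move/eqP: ki; apply; apply: (embedding_inj embK).
  apply: (cubic_morph_eq cubicK shape_basis_ratio).
  rewrite -rhoE fmorph_div fmorph_div rmorphM fmorphV /=.
  have su : sigma i u != 0 by rewrite fmorph_eq0 shape_basis_neq0.
  have ruC : (rho u)%:C != 0 by rewrite fmorph_eq0.
  apply: (mulIf su); rewrite divfK //; apply: (mulIf ruC).
  rewrite mulrAC divfK // (sE _ tu) (sE _ tv).
  apply/eqP; rewrite eq_complex /=; apply/andP; split; apply/eqP; lra.
rewrite [ltRHS](_ : _ = 12 * (rho v * im u - rho u * im v) ^+ 2); last by field.
by apply: mulr_gt0; rewrite ?exprn_even_gt0.
Qed.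

End ComplexCubic.

(** * Recovering the field from the shape *)

Lemma cubic_form_over_image (R : realType) (L : fieldExtType rat)
    (sigma : 'I_3 -> {rmorphism L -> R[i]}) (a1 a2 : L) :
    cubic_field L -> complex_embeddings sigma ->
  exists rho : {rmorphism L -> R},
    forall x y, in_image rho (shape_form sigma a1 a2 x y).
Proof.
move=> cL embL.
have t0 x y : field_trace (perp a1 *~ x + perp a2 *~ y) = 0.
  by rewrite field_traceD -!scaler_int !field_traceZ !field_trace_perp // !mulr0 addr0.
case: (embeddings_real_or_conj embL) => [h|[i [j [k [_ S ij kk]]]]].
  (* In the totally real case the values are rational, so any real embedding will do. *)
  have [rho rhoE] := real_embedding (h ord0); exists rho => x y.
  rewrite /shape_form -/(sum_sqr_norm sigma _).
  rewrite (sum_sqr_norm_real cL embL _ h) -(rmorph_ratA rho).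
  by eexists.
have [rho rhoE] := real_embedding kk; exists rho => x y.
rewrite /shape_form -/(sum_sqr_norm sigma _).
rewrite (sum_sqr_norm_complex cL embL S ij rhoE) //.
by eexists.
Qed.

Lemma cubic_shape_eq_isomorphic (R : realType) (K L : fieldExtType rat) :
    complex_cubic_field R K -> cubic_field L ->
    cubic_shape R K = cubic_shape R L ->
  isomorphic_fields K L.
Proof.
move=> complexK cL eqsh; have [cK _] := complexK.
have [sigma embK] := complex_embeddings_exist R cK.
have [a1 [a2 basisK]] := integral_basis1_exists R cK.
(* Shapes are sets, so their equality is used through a member: the point of [K], moved by the
   identity, must also come from [L]. *)
have : cubic_shape R K (GL2Z_act 1%:M (form_point (shape_form sigma a1 a2))).
  by exists sigma, a1, a2; split=> //; exists 1%:M; rewrite ?unitmx1.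
rewrite eqsh => -[tau [b1 [b2 [embL _ [h _ eh]]]]].
have [rhoL rhoLP] := cubic_form_over_image b1 b2 cL embL.
have [rho [rhoP]] := complex_cubic_form complexK embK basisK.
set u := perp a1; set v := perp a2 => /= -[r0 disc].
have Q10 : shape_form sigma a1 a2 1 0 = sum_sqr_norm sigma u.
  by rewrite /shape_form mulr1z mulr0z addr0.
have Q01 : shape_form sigma a1 a2 0 1 = sum_sqr_norm sigma v.
  by rewrite /shape_form mulr1z mulr0z add0r.
have Q11 : shape_form sigma a1 a2 1 1 = sum_sqr_norm sigma (u + v).
  by rewrite /shape_form !mulr1z.
have z0 : complex.Im (form_point (shape_form sigma a1 a2)) != 0.
  rewrite /form_point Q10 Q01 Q11 /=; apply: mulf_neq0.
    by rewrite gt_eqF // sqrtr_gt0.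
  by rewrite invr_eq0; apply: mulf_neq0 => //; rewrite pnatr_eq0.
have zK := point_over_image_orbit (unitmx1 _ _) z0 eh (form_point_over_image rhoLP).
have := form_point_ratios _ _ zK; rewrite Q10 Q01 Q11 => /(_ r0 (ltW disc)).
have tu : field_trace u = 0 by apply: field_trace_perp.
have tv : field_trace v = 0 by apply: field_trace_perp.
have tuv : field_trace (u + v) = 0 by rewrite field_traceD tu tv addr0.
rewrite !rhoP //; rewrite rhoP // fmorph_eq0 in r0.
(* Polarisation: s / r becomes the image of twice the ratio of perp(u v) to perp(u^2). *)
have -> : perp ((u + v) ^+ 2) = perp (u ^+ 2) + perp (v ^+ 2) + 2 *: perp (u * v).
  by rewrite sqrrD addrAC -scaler_nat !perpD perpZ.
rewrite -!rmorphB -!fmorph_div => -[[l1 el1] [l2 el2]].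
have /orP[h1|h1] : (perp (u * v) / perp (u ^+ 2) \notin 1%VS) ||
    (perp (v ^+ 2) / perp (u ^+ 2) \notin 1%VS).
- rewrite -implybE; apply/implyP; apply: perp_products_irrational => //.
    exact: shape_basis_neq0 basisK.
  exact: shape_basis_ratio basisK.
- apply: (isomorphic_of_common_irrational cK cL _ el1).
  apply: contra h1.
  set X := (X in X \in _ -> _).
  have -> : X = 2 *: (perp (u * v) / perp (u ^+ 2)).
    by rewrite /X scalerAl; congr (_ / _); ring.
  by rewrite rpredZeq.
exact: (isomorphic_of_common_irrational cK cL h1 el2).
Qed.

Theorem theoremA (R : realType) :
  (forall K L : fieldExtType rat,
      complex_cubic_field R K -> cubic_field L -> ~ isomorphic_fields K L ->
      cubic_shape R K <> cubic_shape R L)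
  /\
  (forall K L : fieldExtType rat,
      complex_cubic_field R K -> complex_cubic_field R L ->
      cubic_shape R K = cubic_shape R L -> isomorphic_fields K L).
Proof.
split=> K L complexK cL; last by apply: cubic_shape_eq_isomorphic => //; case: cL.
by move=> KL /(cubic_shape_eq_isomorphic complexK cL).
Qed.
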